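(* Let $\Gamma=(X,R)$ be a connected $k$-regular graph with adjacency matrix $A$, $d+1$ distinct (adjacency) eigenvalues, diameter $D$, and predistance polynomials $p_0,p_1,\ldots,p_d$. Let $q_{D-1}=p_0+p_1+\cdots+p_{D-1}$. Then $$ \frac{|X|}{\sum_{x\in X}\frac{1}{|X|-|\Gamma_D(x)|}}\ \ge\ q_{D-1}(k)=|X|-\sum_{i=D}^d p_i(k), $$ and equality holds in the inequality if and only if $A_D=\sum_{i=D}^d p_i(A)$.
   Context: Graphs are finite, simple, undirected, connected, with vertex set $X$, $n=|X|\ge 2$. For $x\in X$, $\Gamma_i(x)$ is the set of vertices at distance exactly $i$ from $x$. $D$ is the diameter, and $A_D$ is the $X\times X$ distance-$D$ matrix: $(A_D)_{xy}=1$ if $x,y$ are at distance $D$, and $0$ otherwise. Let $\lambda_0>\lambda_1>\cdots>\lambda_d$ be the distinct eigenvalues of the adjacency matrix $A$, with multiplicities $m(\lambda_i)$; for a connected $k$-regular graph $\lambda_0=k$. On the real polynomials of degree at most $d$ consider the scalar product $$\langle f,g\rangle_A=\frac1n\operatorname{tr}(f(A)g(A))=\frac1n\sum_{i=0}^d m(\lambda_i)f(\lambda_i)g(\lambda_i).$$ The predistance polynomials $p_0,\ldots,p_d$ are the unique sequence of polynomials with $\deg p_i=i$, pairwise orthogonal for $\langle\cdot,\cdot\rangle_A$, normalized so that $\|p_i\|_A^2=\langle p_i,p_i\rangle_A=p_i(\lambda_0)$. *)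

(* Defs.v *)
From HB Require Import structures.
From mathcomp Require Import all_boot all_order all_algebra.

Set Implicit Arguments.
Unset Strict Implicit.
Unset Printing Implicit Defensive.

Import Order.TTheory GRing.Theory Num.Theory.
Local Open Scope ring_scope.

Section Graph.
Variables (T : finType) (e : rel T).

Definition simple_graph := symmetric e /\ irreflexive e.

Definition connected_graph := forall x y : T, connect e x y.

Definition regular_graph (k : nat) := forall x : T, #|[set y | e x y]| = k.

Definition has_walk (x y : T) (m : nat) : bool :=
  [exists s : m.-tuple T, path e x s && (last x s == y)].

(* Geodesic distance. A shortest walk has fewer than #|T| edges, so the bounded
   search is enough; the value is #|T| when y is unreachable from x. *)
Definition gdist (x y : T) : nat := find (has_walk x y) (iota 0 #|T|).

Definition diameter : nat := \max_(x : T) \max_(y : T) gdist x y.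

Definition sphere (i : nat) (x : T) : {set T} := [set y | gdist x y == i].

(* X x X matrices are indexed by 'I_#|T| through the enumeration of T. *)
Definition adjmx (R : nzRingType) : 'M[R]_#|T| :=
  \matrix_(i, j) (e (enum_val i) (enum_val j))%:R.

Definition distmx (R : nzRingType) (m : nat) : 'M[R]_#|T| :=
  \matrix_(i, j) (gdist (enum_val i) (enum_val j) == m)%:R.

End Graph.

(* p(A). The library's horner_mx is restricted to sizes of the form n.+1, which
   #|T| is not syntactically; evalmx_horner says that the two agree there. *)
Definition evalmx (R : comNzRingType) (n : nat) (A : 'M[R]_n) (p : {poly R})
    : 'M[R]_n :=
  \sum_(i < size p) p`_i *: A ^+ i.

Lemma evalmx_horner (R : comNzRingType) (n : nat) (A : 'M[R]_n.+1) (p : {poly R}) :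
  evalmx A p = horner_mx A p.
Proof.
rewrite /evalmx -[p in RHS]coefK poly_def linear_sum /=.
by apply: eq_bigr => i _; rewrite linearZ /= rmorphXn /= horner_mx_X.
Qed.

Definition distinct_eigenvalues (R : realFieldType) (n d : nat) (A : 'M[R]_n)
    (lam : 'I_d.+1 -> R) : Prop :=
  (forall i j : 'I_d.+1, (i < j)%N -> lam j < lam i) /\
  (forall a : R, eigenvalue A a <-> exists i, lam i = a).

Definition trace_prod (R : fieldType) (n : nat) (A : 'M[R]_n) (f g : {poly R}) : R :=
  n%:R^-1 * \tr (evalmx A f *m evalmx A g).

(* The condition size (p i) = i.+1 says that p i has degree exactly i. *)
Definition predistance_polys (R : fieldType) (n d : nat) (A : 'M[R]_n) (lam0 : R)
    (p : 'I_d.+1 -> {poly R}) : Prop :=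
  [/\ forall i, size (p i) = i.+1,
      forall i j, i != j -> trace_prod A (p i) (p j) = 0
    & forall i, trace_prod A (p i) (p i) = (p i).[lam0]].

(* Main.v *)
Require Import Defs.
From HB Require Import structures.
From mathcomp Require Import all_boot all_order all_algebra.
From mathcomp Require Import spectral complex ring.

Set Implicit Arguments.
Unset Strict Implicit.
Unset Printing Implicit Defensive.

Import Order.TTheory GRing.Theory Num.Theory.
Local Open Scope ring_scope.

(** Write q = q_{D-1}, Q = q(A), c = q(k) and N(x) for the set of vertices that
are not at distance D from x.  Three facts about Q carry the proof.

- Since q has degree below D, the entry of Q at (x, y) vanishes for y outside
  N(x): a nonzero entry of A^m comes from a walk of length m (evalmx_far).
- Since A is k-regular, every row of Q sums to c (row_sum_evalmx).
- Since the p_i are orthogonal with squared norm p_i(k), the squared norm of q is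
  q(k) (trace_prod_sum_sq); that is, the squares of all entries of Q sum to n c.

A row of Q thus has total c and is carried by N(x), so the sum of its squares is
c^2 / |N(x)| plus its squared deviation from the constant c / |N(x)| on N(x)
(sumr_sq_dev).  Summing over the rows, with S = sum_x 1 / |N(x)|,

  c (n - c S) = sum_x sum_{y in N(x)} (Q_xy - c / |N(x)|)^2 >= 0.

As c > 0 this is the inequality n / S >= c, with equality exactly when each row of
Q is constant on N(x), say equal to r(x).

The equality case compares Q with the distance matrix through the Hoffman identity
p_0(A) + ... + p_d(A) = J, the all-ones matrix (sum_predistance), which says that
the tail sum_{i >= D} p_i(A) is J - Q.  If D > 1, adjacent vertices belong to each
other's N, so the symmetry of Q makes r constant along edges, hence constant, and
tr Q = n makes it 1; if D = 1 then Q is the identity.  So Q is 1 on N(x) and 0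
elsewhere, which is to say that J - Q = A_D.  Conversely, if J - Q = A_D then Q is
1 on N(x), so that all |N(x)| equal c and the deviations vanish.

The Hoffman identity comes from two facts.  First, J is a polynomial f(A) of degree
at most d: by diagonalization of A the product of the (A - lambda_i) is zero, so
the rows of the product over i > 0 lie in the eigenspace of k, which connectivity
reduces to the constant vectors (degree_eigenvector_const).  Secondly, f and p_i
have scalar product tr(J p_i(A)) / n = p_i(k), which is the squared norm of p_i, so
every coordinate of f in the orthogonal basis (p_i) is 1. *)

(** * Polynomials evaluated at a square matrix *)

Lemma evalmxD (R : comNzRingType) n (A : 'M[R]_n) (p q : {poly R}) :
  evalmx A (p + q) = evalmx A p + evalmx A q.
Proof.
case: n A => [|n] A; first by rewrite [LHS]flatmx0 [RHS]flatmx0.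
by rewrite !evalmx_horner rmorphD.
Qed.

Lemma evalmxZ (R : comNzRingType) n (A : 'M[R]_n) a (p : {poly R}) :
  evalmx A (a *: p) = a *: evalmx A p.
Proof.
case: n A => [|n] A; first by rewrite [LHS]flatmx0 [RHS]flatmx0.
by rewrite !evalmx_horner linearZ.
Qed.

Lemma evalmxM (R : comNzRingType) n (A : 'M[R]_n) (p q : {poly R}) :
  evalmx A (p * q) = evalmx A p *m evalmx A q.
Proof.
case: n A => [|n] A; first by rewrite [LHS]flatmx0 [RHS]flatmx0.
by rewrite !evalmx_horner rmorphM.
Qed.

Lemma evalmxC (R : comNzRingType) n (A : 'M[R]_n) a :
  evalmx A a%:P = a%:M.
Proof.
case: n A => [|n] A; first by rewrite [LHS]flatmx0 [RHS]flatmx0.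
by rewrite !evalmx_horner horner_mx_C.
Qed.

Lemma evalmxX (R : comNzRingType) n (A : 'M[R]_n) : evalmx A 'X = A.
Proof.
case: n A => [|n] A; first by rewrite [LHS]flatmx0 [RHS]flatmx0.
by rewrite !evalmx_horner horner_mx_X.
Qed.

Lemma evalmx0 (R : comNzRingType) n (A : 'M[R]_n) : evalmx A 0 = 0.
Proof. by rewrite -[0 in LHS](scale0r 0) evalmxZ scale0r. Qed.

Lemma evalmx_sum (R : comNzRingType) n (A : 'M[R]_n) (I : Type) (r : seq I)
    (P : pred I) (F : I -> {poly R}) :
  evalmx A (\sum_(i <- r | P i) F i) = \sum_(i <- r | P i) evalmx A (F i).
Proof.
apply: (big_morph (evalmx A)); [exact: evalmxD | exact: evalmx0].
Qed.

Lemma evalmx_tr (R : comNzRingType) n (A : 'M[R]_n) (p : {poly R}) :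
  A^T = A -> (evalmx A p)^T = evalmx A p.
Proof.
move=> Asym; rewrite /evalmx linear_sum; apply: eq_bigr => i _.
rewrite linearZ /=; congr (_ *: _).
elim: (val i) => [|m IHm]; first by rewrite !expr0 trmx1.
by rewrite exprS -mulmxE trmx_mul IHm Asym mulmxE -exprS -exprSr.
Qed.

Lemma eigen_evalmx (R : comNzRingType) n (A : 'M[R]_n) (p : {poly R})
    (v : 'rV_n) a :
  v *m A = a *: v -> v *m evalmx A p = p.[a] *: v.
Proof.
move=> vA; rewrite /evalmx horner_coef mulmx_sumr scaler_suml.
apply: eq_bigr => i _; rewrite -scalemxAr -scalerA; congr (_ *: _).
elim: (val i) => [|m IHm]; first by rewrite !expr0 mulmx1 scale1r.
by rewrite exprSr -mulmxE mulmxA IHm -scalemxAl vA scalerA exprSr.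
Qed.

(** Over the complex numbers A is a Hermitian matrix, hence P^-1 diag(s) P with
real s.  The entries of s are eigenvalues of A, which the polynomial kills. *)
Lemma sym_annihilator (R : rcfType) n (A : 'M[R]_n) (s : seq R) :
  A^T = A -> (forall a, eigenvalue A a -> a \in s) ->
  evalmx A (\prod_(a <- s) ('X - a%:P)) = 0.
Proof.
case: n A => [|n] A Asym As; first exact: flatmx0.
pose f := real_complex R; pose B := map_mx f A.
have Bherm : B \is hermsymmx.
  apply: realsym_hermsym.
    by apply/is_hermitianmxP; rewrite expr0 scale1r map_mx_id // /B map_trmx Asym.
  by apply/mxOverP => i j; rewrite mxE; apply/complex_realP; exists (A i j).
have /hermitian_normalmx/orthomx_spectralP Bdiag := Bherm.
have sp_real := hermitian_spectral_diag_real Bherm.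
set P := spectralmx B in Bdiag; set sp := spectral_diag B in Bdiag sp_real.
have Punit : P \in unitmx := spectral_unit B.
apply: (map_mx_inj (f := f)).
rewrite evalmx_horner map_horner_mx -/B map_mx0 Bdiag horner_mx_uconjC //.
rewrite horner_mx_diag (_ : map_mx _ sp = 0) ?linear0 ?mulmx0 ?mul0mx //.
apply/rowP => j; rewrite !mxE.
have /mxOverP /(_ 0 j) /complex_realP [a aE] := sp_real.
rewrite aE -[a%:C%C]/(f a) horner_map /=.
suff /As: eigenvalue A a.
  by rewrite -root_prod_XsubC => /rootP ->; rewrite rmorph0.
(* The j-th row of P is an eigenvector, nonzero because P is invertible. *)
rewrite -(eigenvalue_map f); apply/eigenvalueP; exists (row j P); last first.
  apply/eqP => Pj0; have := row_mul j P (invmx P).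
  rewrite Pj0 mul0mx mulmxV // => /rowP/(_ j)/eqP.
  by rewrite !mxE eqxx oner_eq0.
rewrite -/B Bdiag rowE mulmxA mulmxA -[_ *m invmx P]mulmxA mulmxV // mulmx1.
by rewrite -(rowE j (diag_mx sp)) row_diag_mx aE -scalemxAl.
Qed.

(** * The trace scalar product and sums of predistance polynomials *)

Lemma poly_basis (R : fieldType) d (p : 'I_d.+1 -> {poly R}) (f : {poly R}) :
  (forall i : 'I_d.+1, size (p i) = i.+1) -> (size f <= d.+1)%N ->
  exists a : 'I_d.+1 -> R, f = \sum_i a i *: p i.
Proof.
(* Induction on a bound m for the size of f, all of the p i being available. *)
move=> szp; move: {1 3}d.+1 (leqnn d.+1) => m.
elim: m f => [|m IHm] f le_md szf.
  exists (fun=> 0); rewrite big1 => [|i _]; last exact: scale0r.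
  by apply/eqP; rewrite -size_poly_leq0.
pose i0 := Ordinal le_md; pose c := f`_m / (p i0)`_m.
have pm0 : (p i0)`_m != 0.
  have -> : m = (size (p i0)).-1 by rewrite szp.
  by rewrite -/(lead_coef _) lead_coef_eq0 -size_poly_eq0 szp.
have [||a fE] := IHm (f - c *: p i0); first exact: ltnW.
  apply/leq_sizeP => j; rewrite leq_eqVlt coefB coefZ => /predU1P[<-|lt_mj].
    by rewrite /c divfK ?subrr.
  by rewrite !nth_default ?szp ?mulr0 ?subrr // (leq_trans szf).
exists (fun i => a i + (if i == i0 then c else 0)).
under eq_bigr do rewrite scalerDl.
rewrite big_split /= -fE (bigD1 i0) //= eqxx big1 ?addr0 ?subrK //.
by move=> i /negPf ->; rewrite scale0r.
Qed.

Section TraceProduct.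
Variables (R : fieldType) (n : nat) (A : 'M[R]_n).

Lemma trace_prod_suml (I : Type) (r : seq I) (P : pred I) (F : I -> {poly R}) g :
  trace_prod A (\sum_(i <- r | P i) F i) g =
  \sum_(i <- r | P i) trace_prod A (F i) g.
Proof.
by rewrite /trace_prod evalmx_sum mulmx_suml raddf_sum /= mulr_sumr.
Qed.

Lemma trace_prodZl a f g : trace_prod A (a *: f) g = a * trace_prod A f g.
Proof. by rewrite /trace_prod evalmxZ -scalemxAl linearZ /= mulrCA. Qed.

Lemma trace_prodC f g : trace_prod A f g = trace_prod A g f.
Proof. by rewrite /trace_prod mxtrace_mulC. Qed.

End TraceProduct.

Section PredistanceSums.
Variables (R : fieldType) (n d : nat) (A : 'M[R]_n) (lam0 : R).
Variables (p : 'I_d.+1 -> {poly R}) (P : pred 'I_d.+1).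
Hypothesis pP : predistance_polys A lam0 p.
Local Notation q := (\sum_(i < d.+1 | P i) p i).

(** The sum of the p_i over a set of indices represents evaluation at lambda_0 on
the span of these p_i, because of the normalization of p_i. *)
Lemma trace_prod_sum_predistance i : P i -> trace_prod A q (p i) = (p i).[lam0].
Proof.
case: pP => _ orth norm Pi.
rewrite trace_prod_suml (bigD1 i) //= norm big1 ?addr0 // => j /andP[_ /orth].
by [].
Qed.

Lemma trace_prod_sum_sq : trace_prod A q q = q.[lam0].
Proof.
rewrite [LHS]trace_prod_suml horner_sum; apply: eq_bigr => i Pi.
by rewrite trace_prodC trace_prod_sum_predistance.
Qed.

Lemma predistance0 : p ord0 = 1.
Proof.
case: pP => szp _ norm; have /eqP/size_poly1P[a a0 pE] := szp ord0.
have n0 : n%:R != 0 :> R.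
  apply: contra a0 => /eqP n0; have := norm ord0.
  by rewrite /trace_prod n0 invr0 mul0r pE hornerC => <-.
have := norm ord0; rewrite pE /trace_prod evalmxC -scalar_mxM mxtrace_scalar.
rewrite -(mulr_natl (a * a)) mulKf // hornerC -[X in _ = X]mulr1 => /(mulfI a0) ->.
by [].
Qed.

Lemma trace_sum_predistance :
  n%:R != 0 :> R -> P ord0 -> \tr (evalmx A q) = n%:R.
Proof.
move=> n0 P0; have := trace_prod_sum_predistance P0.
rewrite predistance0 hornerC /trace_prod evalmxC mulmx1.
by move/(canRL (mulVKf n0)); rewrite mulr1.
Qed.

End PredistanceSums.


(** * The Hoffman identity *)

Section HoffmanIdentity.
Variables (R : rcfType) (n d : nat) (A : 'M[R]_n).
Variables (lam : 'I_d.+1 -> R) (p : 'I_d.+1 -> {poly R}).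
Hypotheses (n_gt0 : (0 < n)%N) (Asym : A^T = A).
Hypotheses (lamP : distinct_eigenvalues A lam).
Hypothesis pP : predistance_polys A (lam ord0) p.
Hypothesis A1 : const_mx 1 *m A = lam ord0 *: const_mx 1 :> 'rV_n.
Hypothesis A1_simple : forall v : 'rV_n,
  v *m A = lam ord0 *: v -> forall i j, v 0 i = v 0 j.

Lemma trace_prod_sqE f :
  n%:R * trace_prod A f f = \sum_i \sum_j evalmx A f i j ^+ 2.
Proof.
rewrite /trace_prod mulVKf ?pnatr_eq0 -?lt0n //.
rewrite /mxtrace; apply: eq_bigr => i _.
rewrite mxE; apply: eq_bigr => j _.
by rewrite -[in X in _ * X](evalmx_tr f Asym) mxE expr2.
Qed.

Lemma lam_inj : injective lam.
Proof.
case: lamP => dec _ i j; case: (ltngtP i j) => [/dec|/dec|/val_inj//];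
  by move=> + E; rewrite E ltxx.
Qed.

(** A polynomial that kills A has the d + 1 eigenvalues of A as roots. *)
Lemma evalmx_eq0 (f : {poly R}) : (size f <= d.+1)%N -> evalmx A f = 0 -> f = 0.
Proof.
move=> szf fA0; apply: (@roots_geq_poly_eq0 _ _ (codom lam)).
- apply/allP => _ /codomP[i ->]; have /(proj2 lamP _): exists j, lam j = lam i.
    by exists i.
  case/eigenvalueP => v vA v0; have := eigen_evalmx f vA.
  by rewrite fA0 mulmx0 => /esym/eqP; rewrite scaler_eq0 (negPf v0) orbF.
- by rewrite map_inj_uniq ?enum_uniq //; apply: lam_inj.
- by rewrite size_codom card_ord.
Qed.

Lemma trace_prod_gt0 (f : {poly R}) :
  (size f <= d.+1)%N -> f != 0 -> 0 < trace_prod A f f.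
Proof.
move=> szf f0; have n0 : 0 < n%:R :> R by rewrite ltr0n.
have sq_ge0 i j : 0 <= evalmx A f i j ^+ 2 by apply: sqr_ge0.
rewrite -(pmulr_rgt0 _ n0) trace_prod_sqE lt0r sumr_ge0 ?andbT; last first.
  by move=> i _; apply: sumr_ge0.
apply: contra f0 => /eqP s0; apply/eqP/evalmx_eq0 => //.
apply/matrixP => i j; rewrite mxE; apply/eqP; rewrite -sqrf_eq0.
have row0 := psumr_eq0P (fun l _ => sumr_ge0 _ (fun m _ => sq_ge0 l m)) s0.
by apply/eqP/(psumr_eq0P (fun m _ => sq_ge0 i m) (row0 i isT)).
Qed.

(** The product phi of the X - lambda_i over i > 0 satisfies
phi(A) (A - lambda_0) = 0, so the rows of phi(A) lie in the eigenspace of lambda_0,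
whose vectors are constant by A1_simple; phi(A) being symmetric, it is a multiple of the all-ones matrix, and a nonzero one since
phi(lambda_0) is nonzero. *)
Lemma allones_poly :
  exists2 f : {poly R}, (size f <= d.+1)%N & evalmx A f = const_mx 1.
Proof.
pose phi := \prod_(a <- [seq lam (lift ord0 i) | i : 'I_d]) ('X - a%:P).
have szphi : size phi = d.+1 by rewrite size_prod_XsubC size_map size_enum_ord.
have phik0 : phi.[lam ord0] != 0.
  rewrite -/(root _ _) root_prod_XsubC; apply/negP => /mapP[i _ /lam_inj].
  by move/eqP; rewrite (negPf (neq_lift _ _)).
have annA : evalmx A phi *m A = lam ord0 *: evalmx A phi.
  have : evalmx A (phi * ('X - (lam ord0)%:P)) = 0.
    pose s := lam ord0 :: [seq lam (lift ord0 i) | i : 'I_d].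
    have -> : phi * ('X - (lam ord0)%:P) = \prod_(a <- s) ('X - a%:P).
      by rewrite big_cons mulrC.
    apply: sym_annihilator => // a /(proj2 lamP) [i <-].
    rewrite inE; case: (unliftP ord0 i) => [j|] ->; last by rewrite eqxx.
    by rewrite map_f ?orbT // mem_enum.
  rewrite evalmxM evalmxD evalmxX -polyCN evalmxC mulmxDr mul_mx_scalar scaleNr.
  by move/eqP; rewrite subr_eq0 => /eqP.
have row_const i j l : evalmx A phi i j = evalmx A phi i l.
  have := @A1_simple (row i (evalmx A phi)).
  by rewrite -row_mul annA linearZ /= => /(_ erefl j l); rewrite !mxE.
have entry_const i j i' j' : evalmx A phi i j = evalmx A phi i' j'.
  rewrite (row_const i j i') (row_const i' j' i).
  by rewrite -[in LHS](evalmx_tr phi Asym) mxE.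
pose i0 := Ordinal n_gt0; pose c := evalmx A phi i0 i0.
have phiA : evalmx A phi = c *: const_mx 1.
  by apply/matrixP => i j; rewrite !mxE mulr1; apply: entry_const.
have c0 : c != 0.
  have /rowP/(_ i0) := eigen_evalmx phi A1; rewrite phiA !mxE mulr1 => h.
  apply: contra phik0 => /eqP cE; rewrite -h cE.
  by rewrite big1 // => i _; rewrite !mxE mul0r mulr0.
exists (c^-1 *: phi); first by rewrite (leq_trans (size_scale_leq _ _)) ?szphi.
by rewrite evalmxZ phiA scalerA mulVf ?scale1r.
Qed.

Lemma row_sum_evalmx f i : \sum_j evalmx A f i j = f.[lam ord0].
Proof.
have /rowP/(_ i) := eigen_evalmx f A1; rewrite !mxE mulr1 => <-.
by apply: eq_bigr => j _; rewrite mxE mul1r -[in RHS](evalmx_tr f Asym) mxE.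
Qed.

(** The polynomial f with f(A) = J has the same scalar product with p_i as p_i
itself, so all its coordinates in the basis (p_i) are 1. *)
Lemma sum_predistance : \sum_i evalmx A (p i) = const_mx 1.
Proof.
case: pP => szp orth norm; have [f szf fA] := allones_poly.
have [a fE] := poly_basis szp szf.
suff a1 i : a i = 1.
  by rewrite -fA fE evalmx_sum; apply: eq_bigr => i _; rewrite a1 scale1r.
have pi_gt0 : 0 < (p i).[lam ord0].
  by rewrite -norm trace_prod_gt0 ?szp ?ltn_ord // -size_poly_eq0 szp.
have fpi : trace_prod A f (p i) = (p i).[lam ord0].
  rewrite /trace_prod fA -[RHS](mulKf (x := n%:R)) ?pnatr_eq0 -?lt0n //.
  congr (_ * _); rewrite mxtrace_mulC /mxtrace.
  under eq_bigr => j _.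
    rewrite mxE; under eq_bigr do rewrite mxE mulr1.
    rewrite row_sum_evalmx; over.
  by rewrite sumr_const card_ord mulr_natl.
move: fpi; rewrite fE trace_prod_suml (bigD1 i) //= big1 => [|j ji].
  rewrite addr0 trace_prodZl norm => /(canRL (mulfK (lt0r_neq0 pi_gt0))) ->.
  by rewrite mulfV ?lt0r_neq0.
by rewrite trace_prodZl orth ?mulr0.
Qed.

End HoffmanIdentity.

(** * Squared deviation from the mean *)

(** The equality case of the Cauchy-Schwarz inequality for a function of total c
carried by N, made explicit: the defect is a sum of squares. *)
Lemma sumr_sq_dev (R : realFieldType) (I : finType) (N : {set I}) (q : I -> R) c :
  (0 < #|N|)%N -> (forall y, y \notin N -> q y = 0) -> \sum_y q y = c ->
  \sum_y q y ^+ 2 =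
    c ^+ 2 / #|N|%:R + \sum_(y in N) (q y - c / #|N|%:R) ^+ 2.
Proof.
move=> N_gt0 qN qc; set m := #|N|%:R; have m0 : m != 0 by rewrite pnatr_eq0 -lt0n.
have onN (F : I -> R) : (forall y, q y = 0 -> F y = 0) ->
    \sum_y F y = \sum_(y in N) F y.
  move=> F0; rewrite [RHS]big_mkcond; apply: eq_bigr => y _.
  by case: ifPn => // /qN/F0.
rewrite onN => [|y ->]; last by rewrite expr0n.
have {}qc : \sum_(y in N) q y = c by rewrite -qc [RHS]onN.
have -> : \sum_(y in N) (q y - c / m) ^+ 2 =
    \sum_(y in N) (q y ^+ 2 - 2 * (c / m) * q y + (c / m) ^+ 2).
  by apply: eq_bigr => y _; ring.
rewrite big_split sumrB /= -mulr_sumr qc sumr_const -mulr_natr -/m.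
by field.
Qed.

(** * Adjacency matrices of regular graphs *)

Lemma connected_const (T : finType) (e : rel T) (U : Type) (F : T -> U) :
  connected_graph e -> (forall x y, e x y -> F x = F y) ->
  forall x y, F x = F y.
Proof.
move=> e_conn edge x y; case/connectP: (e_conn x y) => s + ->.
by elim: s x => //= z s IHs x /andP[/edge -> /IHs].
Qed.

Section GraphMatrices.
Variables (R : rcfType) (T : finType) (e : rel T).
Local Notation A := (adjmx e R).

Lemma sum_enum_val (F : T -> R) : \sum_(i < #|T|) F (enum_val i) = \sum_x F x.
Proof.
by rewrite -(big_enum_val F).
Qed.

Lemma adjmx_tr : symmetric e -> A^T = A.
Proof. by move=> es; apply/matrixP => i j; rewrite !mxE es. Qed.

Section Regular.
Variable k : nat.
Hypotheses (e_sym : symmetric e) (e_reg : regular_graph e k).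

Lemma adjmx_row_sum i : \sum_j A i j = k%:R.
Proof.
under eq_bigr do rewrite mxE.
rewrite (sum_enum_val (fun y => (e (enum_val i) y)%:R)) -(e_reg (enum_val i)).
rewrite -sum1_card natr_sum [RHS]big_mkcond; apply: eq_bigr => y _.
by rewrite inE; case: (e _ y).
Qed.

Lemma adjmx_ones : const_mx 1 *m A = k%:R *: const_mx 1 :> 'rV_#|T|.
Proof.
apply/rowP => j; rewrite !mxE mulr1 -(adjmx_row_sum j).
by apply: eq_bigr => i _; rewrite mxE mul1r -[in LHS](adjmx_tr e_sym) mxE.
Qed.

(** The quadratic form of the Laplacian at an eigenvector.  Its nonnegativity
bounds the eigenvalues by k, and its vanishing at an eigenvector of k forces that
vector to be constant along edges. *)
Lemma laplacian_form (v : 'rV[R]_#|T|) a : v *m A = a *: v ->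
  \sum_i \sum_j A i j * (v 0 i - v 0 j) ^+ 2 =
    2 * (k%:R - a) * \sum_i v 0 i ^+ 2.
Proof.
move=> vA.
have sq : \sum_i \sum_j A i j * v 0 i ^+ 2 = k%:R * \sum_i v 0 i ^+ 2.
  rewrite mulr_sumr; apply: eq_bigr => i _.
  by rewrite -mulr_suml adjmx_row_sum.
have cross : \sum_i \sum_j A i j * (v 0 i * v 0 j) = a * \sum_i v 0 i ^+ 2.
  rewrite exchange_big mulr_sumr; apply: eq_bigr => j _.
  have /rowP/(_ j) := vA; rewrite !mxE expr2 mulrA => <-.
  by rewrite mulr_suml; apply: eq_bigr => i _; ring.
have sq' : \sum_i \sum_j A i j * v 0 j ^+ 2 = k%:R * \sum_i v 0 i ^+ 2.
  rewrite exchange_big -sq; apply: eq_bigr => i _; apply: eq_bigr => j _.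
  by rewrite -[in LHS](adjmx_tr e_sym) mxE.
transitivity (\sum_i \sum_j (A i j * v 0 i ^+ 2 + A i j * v 0 j ^+ 2
                            - 2 * (A i j * (v 0 i * v 0 j)))).
  by apply: eq_bigr => i _; apply: eq_bigr => j _; ring.
under eq_bigr do rewrite sumrB big_split /= -mulr_sumr.
by rewrite sumrB big_split /= -mulr_sumr sq sq' cross; ring.
Qed.

Lemma adjmx_ge0 i j : 0 <= A i j.
Proof. by rewrite mxE ler0n. Qed.

Lemma eigenvalue_le_degree a : eigenvalue A a -> a <= k%:R.
Proof.
case/eigenvalueP => v vA v0; have := laplacian_form vA.
have s_gt0 : 0 < \sum_i v 0 i ^+ 2.
  rewrite lt0r sumr_ge0 ?andbT => [|i _]; last exact: sqr_ge0.
  apply: contra v0 => /eqP s0; apply/eqP/rowP => i; rewrite mxE; apply/eqP.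
  by rewrite -sqrf_eq0 (psumr_eq0P (fun i _ => sqr_ge0 (v 0 i)) s0).
move=> E; rewrite -subr_ge0 -(pmulr_lge0 _ s_gt0) -(pmulr_rge0 _ (ltr0n R 2)).
rewrite mulrA -E; apply: sumr_ge0 => i _; apply: sumr_ge0 => j _.
by rewrite mulr_ge0 ?sqr_ge0 ?adjmx_ge0.
Qed.

Lemma degree_eigenvector_const (v : 'rV[R]_#|T|) : connected_graph e ->
  v *m A = k%:R *: v -> forall i j, v 0 i = v 0 j.
Proof.
move=> e_conn /laplacian_form; rewrite subrr mulr0 mul0r => s0.
have term_ge0 i j : 0 <= A i j * (v 0 i - v 0 j) ^+ 2.
  by rewrite mulr_ge0 ?sqr_ge0 ?adjmx_ge0.
have edge x y : e x y -> v 0 (enum_rank x) = v 0 (enum_rank y).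
  have row0 := psumr_eq0P (fun i _ => sumr_ge0 _ (fun j _ => term_ge0 i j)) s0.
  have := psumr_eq0P (fun j _ => term_ge0 (enum_rank x) j) (row0 _ isT).
  move=> /(_ (enum_rank y) isT)/eqP; rewrite mxE !enum_rankK => + exy.
  by rewrite exy mul1r sqrf_eq0 subr_eq0 => /eqP.
move=> i j; rewrite -(enum_valK i) -(enum_valK j).
exact: connected_const e_conn edge _ _.
Qed.

Lemma largest_eigenvalue d (lam : 'I_d.+1 -> R) : (0 < #|T|)%N ->
  distinct_eigenvalues A lam -> lam ord0 = k%:R.
Proof.
move=> T_gt0 [dec lamP]; apply/le_anti/andP; split.
  by apply: eigenvalue_le_degree; apply/lamP; exists ord0.
have /lamP[i <-] : eigenvalue A k%:R.
  apply/eigenvalueP; exists (const_mx 1); first exact: adjmx_ones.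
  apply/eqP => /rowP/(_ (Ordinal T_gt0)); rewrite !mxE => /eqP.
  by rewrite oner_eq0.
by case: (posnP i) => [/(@val_inj _ _ _ i ord0) ->|/(dec ord0)/ltW].
Qed.

End Regular.

(** * Walks and distances *)

Lemma gdist_le x y m : has_walk e x y m -> (gdist e x y <= m)%N.
Proof.
move=> w; rewrite leqNgt; apply/negP => lt_m.
have lt_mT : (m < #|T|)%N.
  by rewrite (leq_trans lt_m) // -[X in (_ <= X)%N](size_iota 0) find_size.
by have := before_find 0 lt_m; rewrite nth_iota // w.
Qed.

Lemma has_walk0 x y : has_walk e x y 0 = (x == y).
Proof.
apply/existsP/eqP => [[s]|->]; first by rewrite (tuple0 s) /= => /eqP.
by exists [tuple]; rewrite /= eqxx.
Qed.

Lemma gdist_eq0 x y : (gdist e x y == 0) = (x == y).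
Proof.
apply/eqP/eqP => [|->]; last first.
  by apply/eqP; rewrite -leqn0 gdist_le // has_walk0.
rewrite /gdist; have : (0 < #|T|)%N by apply/card_gt0P; exists x.
by case: #|T| => //= m _; rewrite has_walk0; case: eqP.
Qed.

Lemma has_walkS x y z m : e x z -> has_walk e z y m -> has_walk e x y m.+1.
Proof.
move=> exz /existsP[s /andP[es ls]]; apply/existsP; exists (cons_tuple z s).
by rewrite /= exz es.
Qed.

Lemma gdist_edge x y : e x y -> (gdist e x y <= 1)%N.
Proof.
by move=> exy; apply: gdist_le; apply: has_walkS exy _; rewrite has_walk0.
Qed.

Lemma gdist_le_diameter x y : (gdist e x y <= diameter e)%N.
Proof.
by apply: leq_trans (leq_bigmax x); apply: (leq_bigmax (F := gdist e x) y).
Qed.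

Lemma diameter_gt0 : (1 < #|T|)%N -> (0 < diameter e)%N.
Proof.
case/card_gt1P => x [y [_ _ neq_xy]].
by rewrite (leq_trans _ (gdist_le_diameter x y)) // lt0n gdist_eq0.
Qed.

Lemma adjmx_exp_walk m i j :
  (A ^+ m) i j != 0 -> has_walk e (enum_val i) (enum_val j) m.
Proof.
elim: m i => [|m IHm] i.
  rewrite expr0 mxE has_walk0 (inj_eq enum_val_inj).
  by case: (i == j) => //; rewrite eqxx.
rewrite exprS -mulmxE mxE; apply: contraNT => nw.
rewrite big1 // => l _; rewrite mxE.
case eil: (e _ _); last by rewrite mul0r.
rewrite mul1r; apply: contraNeq nw => /IHm.
exact: has_walkS eil.
Qed.

Lemma evalmx_far (f : {poly R}) i j :
  (size f <= gdist e (enum_val i) (enum_val j))%N -> evalmx A f i j = 0.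
Proof.
move=> far; rewrite /evalmx summxE big1 // => l _; rewrite mxE.
case: (eqVneq ((A ^+ l) i j) 0) => [->|/adjmx_exp_walk/gdist_le].
  exact: mulr0.
by rewrite leqNgt (leq_trans (ltn_ord l) far).
Qed.

End GraphMatrices.

(** * The spectral bound *)

Theorem theorem2p1 (R : rcfType) (T : finType) (e : rel T) (k d : nat)
    (lam : 'I_d.+1 -> R) (p : 'I_d.+1 -> {poly R})
    (cardT : (2 <= #|T|)%N)
    (e_simple : simple_graph e)
    (e_conn : connected_graph e)
    (e_reg : regular_graph e k)
    (lamP : distinct_eigenvalues (adjmx e R) lam)
    (pP : predistance_polys (adjmx e R) (lam ord0) p) :
  let A := adjmx e R in
  let D := diameter e in
  let n : R := #|T|%:R in
  let q : {poly R} := \sum_(i < d.+1 | (i < D)%N) p i in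
  let h : R := n / (\sum_(x : T) 1 / (n - #|sphere e D x|%:R)) in
  [/\ q.[k%:R] <= h,
      q.[k%:R] = n - \sum_(i < d.+1 | (D <= i)%N) (p i).[k%:R]
    & h = q.[k%:R] <->
      distmx e R D = \sum_(i < d.+1 | (D <= i)%N) evalmx A (p i)].
Proof.
move=> A D n q h; have [e_sym _] := e_simple.
have T_gt0 : (0 < #|T|)%N by apply: ltnW.
have n_gt0 : 0 < n by rewrite ltr0n.
have n0 := lt0r_neq0 n_gt0.
have D_gt0 : (0 < D)%N := diameter_gt0 e cardT.
have Asym : A^T = A := adjmx_tr R e_sym.
have lam0 : lam ord0 = k%:R := largest_eigenvalue e_sym e_reg T_gt0 lamP.
have A1 : const_mx 1 *m A = lam ord0 *: const_mx 1 :> 'rV_#|T|.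
  by rewrite lam0; apply: adjmx_ones.
have A1_simple (v : 'rV_#|T|) :
    v *m A = lam ord0 *: v -> forall i j, v 0 i = v 0 j.
  by rewrite lam0; apply: degree_eigenvector_const.
have hoffman : \sum_i evalmx A (p i) = const_mx 1.
  exact: (sum_predistance T_gt0 Asym lamP pP A1 A1_simple).
pose low (i : 'I_d.+1) := (i < D)%N; pose Q := evalmx A q; pose c := q.[k%:R].
have split_p (V : zmodType) (F : 'I_d.+1 -> V) :
    \sum_(i < d.+1 | (i < D)%N) F i + \sum_(i < d.+1 | (D <= i)%N) F i =
    \sum_i F i.
  rewrite [RHS](bigID (fun i : 'I_d.+1 => (i < D)%N)) /=; congr (_ + _).
  by apply: eq_bigl => i; rewrite -leqNgt.
have tail : \sum_(i < d.+1 | (D <= i)%N) evalmx A (p i) = const_mx 1 - Q.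
  by rewrite -hoffman -split_p /Q /q evalmx_sum addrC addKr.
have row_sumQ i : \sum_j Q i j = c.
  by rewrite (row_sum_evalmx Asym A1) lam0.
(* Comparison of the two sides of the Hoffman identity on the sum of one row. *)
have cE : c = n - \sum_(i < d.+1 | (D <= i)%N) (p i).[k%:R].
  apply/(canRL (addrK _)); rewrite /c /q horner_sum split_p -lam0.
  pose i0 := Ordinal T_gt0.
  transitivity (\sum_i \sum_j evalmx A (p i) i0 j).
    by apply: eq_bigr => i _; rewrite (row_sum_evalmx Asym A1).
  rewrite exchange_big /=; under eq_bigr do rewrite -summxE hoffman mxE.
  by rewrite sumr_const card_ord.
have szp i : size (p i) = i.+1 by case: pP.
have szq : (size q <= D)%N.
  apply: leq_trans (size_sum _ _ _) _; apply/bigmax_leqP => i.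
  by rewrite szp.
have szq_d : (size q <= d.+1)%N.
  apply: leq_trans (size_sum _ _ _) _; apply/bigmax_leqP => i _.
  by rewrite szp.
have normQ : trace_prod A q q = q.[lam ord0] := trace_prod_sum_sq low pP.
have trQ : \tr Q = n := trace_sum_predistance (P := low) pP n0 D_gt0.
have c_gt0 : 0 < c.
  have q0 : q != 0.
    by apply: contraNneq n0 => q0; rewrite -trQ /Q q0 evalmx0 mxtrace0.
  by rewrite /c -lam0 -normQ (trace_prod_gt0 T_gt0 Asym lamP).
(* Since D > 0, a vertex lies in its own N, which is therefore nonempty. *)
pose N (i : 'I_#|T|) : {set 'I_#|T|} :=
  [set j | gdist e (enum_val i) (enum_val j) != D].
have N_refl i : i \in N i.
  have /eqP d0 : gdist e (enum_val i) (enum_val i) == 0 by rewrite gdist_eq0.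
  by rewrite inE d0 eq_sym -lt0n.
have N_gt0 i : (0 < #|N i|)%N by apply/card_gt0P; exists i.
have cardN i : #|N i|%:R = n - #|sphere e D (enum_val i)|%:R :> R.
  have -> : N i = enum_val @^-1: ~: sphere e D (enum_val i).
    by apply/setP => j; rewrite !inE.
  rewrite on_card_preimset; last exact/onW_bij/enum_val_bij.
  by apply/(canRL (addrK _)); rewrite -natrD addnC cardsC.
have Q_off i j : j \notin N i -> Q i j = 0.
  by rewrite inE negbK => /eqP far; apply: evalmx_far; rewrite far.
pose S := \sum_i #|N i|%:R^-1 : R.
have hE : h = n / S.
  rewrite /h -(sum_enum_val (fun x => 1 / (n - #|sphere e D x|%:R))).
  by congr (_ / _); apply: eq_bigr => i _; rewrite cardN div1r.
have S_gt0 : 0 < S.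
  rewrite /S (bigD1 (Ordinal T_gt0)) //= ltr_pwDl ?invr_gt0 ?ltr0n //.
  by apply: sumr_ge0 => i _; rewrite invr_ge0 ler0n.
pose dev i := \sum_(j in N i) (Q i j - c / #|N i|%:R) ^+ 2.
have dev_ge0 i : 0 <= dev i by apply: sumr_ge0 => j _; apply: sqr_ge0.
have key : c * (n - c * S) = \sum_i dev i.
  have := trace_prod_sqE T_gt0 Asym q.
  rewrite normQ lam0 -/c -/Q.
  under eq_bigr => i _ do rewrite (sumr_sq_dev (N_gt0 i) (Q_off i) (row_sumQ i)).
  rewrite big_split /= -mulr_sumr -/S -/n => E.
  have -> : c * (n - c * S) = n * c - c ^+ 2 * S by ring.
  by rewrite E addrAC subrr add0r.
have hc : h = c <-> \sum_i dev i = 0.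
  rewrite -key hE; split=> [/(canRL (divfK (lt0r_neq0 S_gt0))) <-|].
    by rewrite subrr mulr0.
  move/eqP; rewrite mulf_eq0 (gt_eqF c_gt0) subr_eq0 => /eqP ->.
  by rewrite mulfK ?lt0r_neq0.
split=> //.
  rewrite hE ler_pdivlMr // -subr_ge0 -(pmulr_rge0 _ c_gt0) key.
  by apply: sumr_ge0 => i _.
rewrite -/c hc tail; split=> [dev0 | distE].
  pose r i := c / #|N i|%:R.
  have Q_on i j : j \in N i -> Q i j = r i.
    move=> jN; have devi := psumr_eq0P (fun i _ => dev_ge0 i) dev0 (i := i) isT.
    have := psumr_eq0P (fun j _ => sqr_ge0 (Q i j - r i)) devi jN.
    by move/eqP; rewrite sqrf_eq0 subr_eq0 => /eqP.
  have r1 i : r i = 1.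
    (* For D = 1 adjacent vertices are at distance D, so that edges give no
       relation between the r i. *)
    have [D1 | D_neq1] := eqVneq D 1.
      have qE : q = 1.
        rewrite /q D1 (bigD1 ord0) //= big1 ?addr0 ?(predistance0 pP) // => j.
        by rewrite ltnS leqn0 => /andP[/eqP j0 /eqP[]]; apply: val_inj.
      by rewrite -(Q_on i i) // /Q qE evalmxC mxE eqxx.
    have Qsym i' j : Q i' j = Q j i'.
      by rewrite /Q -[in LHS](evalmx_tr q Asym) mxE.
    have edgeN x y : e x y -> enum_rank y \in N (enum_rank x).
      move=> exy; rewrite inE !enum_rankK; apply: contra D_neq1 => /eqP far.
      by rewrite eqn_leq D_gt0 -far gdist_edge.
    have r_edge x y : e x y -> r (enum_rank x) = r (enum_rank y).
      move=> exy; rewrite -(Q_on _ _ (edgeN _ _ exy)) Qsym.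
      by apply: Q_on; apply: edgeN; rewrite e_sym.
    have r_const j : r j = r i.
      rewrite -(enum_valK j) -(enum_valK i).
      exact: connected_const e_conn r_edge _ _.
    have := trQ; rewrite /mxtrace.
    under eq_bigr => j _ do rewrite Q_on // r_const.
    rewrite sumr_const card_ord -mulr_natl => /(canRL (mulKf n0)) ->.
    by rewrite mulVf.
  apply/matrixP => i j; rewrite !mxE.
  have [jN | jN] := boolP (j \in N i).
    by rewrite Q_on // r1 subrr; move: jN; rewrite inE => /negPf ->.
  by rewrite Q_off // subr0; move: jN; rewrite inE negbK => ->.
have QE i j : Q i j = (j \in N i)%:R.
  rewrite -[LHS](subKr 1).
  have /matrixP/(_ i j) := distE; rewrite !mxE inE => <-.
  by case: eqP => _; rewrite ?subrr ?subr0.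
have cN i : c = #|N i|%:R.
  rewrite -(row_sumQ i) -sum1_card natr_sum [RHS]big_mkcond.
  by apply: eq_bigr => j _; rewrite QE; case: (j \in N i).
apply: big1 => i _; apply: big1 => j jN.
by rewrite QE jN -cN divff ?lt0r_neq0 // subrr expr0n.
Qed.
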